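(* Let $\kappa$ be an uncountable cardinal with $\kappa^{<\kappa}=\kappa$, and suppose that $\lambda^\omega<\kappa$ for all $\lambda<\kappa$. Then there is a continuous reduction of $\sqsubseteq^\omega$ to $\sqsubseteq_{\mathrm{DLO}}$, i.e. a continuous map $F\colon2^\kappa\to\mathrm{Mod}^\kappa_{\mathrm{DLO}}$ such that for all $\eta,\xi\in2^\kappa$: $\eta\sqsubseteq^\omega\xi$ if and only if $\mathcal{A}_{F(\eta)}$ embeds into $\mathcal{A}_{F(\xi)}$.
   Context: $\kappa^\kappa$ carries the bounded topology (basic open sets $\{\eta\mid p\subset\eta\}$, $p\in\kappa^{<\kappa}$) and $2^\kappa$ the subspace topology. For $\eta,\xi\in2^\kappa$, $\eta\sqsubseteq^\omega\xi$ means that $(\eta^{-1}\{1\}\setminus\xi^{-1}\{1\})\cap S^\kappa_\omega$ is non-stationary, where $S^\kappa_\omega=\{\alpha<\kappa\mid\mathrm{cf}(\alpha)=\omega\}$. Coding of structures: fix a bijection $\pi\colon\kappa^{<\omega}\to\kappa$; for a countable relational vocabulary $\{P_n\mid n<\omega\}$ and $\eta\in2^\kappa$, $\mathcal{A}_\eta$ is the structure with domain $\kappa$ in which, for $P_m$ of arity $n$, $(a_1,\dots,a_n)\in P_m^{\mathcal{A}_\eta}$ iff $\eta(\pi(m,a_1,\dots,a_n))=1$. $\mathrm{Mod}^\kappa_{\mathrm{DLO}}=\{\eta\in2^\kappa\mid\mathcal{A}_\eta$ is a dense linear order without endpoints$\}$ (with subspace topology), and $\sqsubseteq_{\mathrm{DLO}}=\{(\eta,\xi)\in(\mathrm{Mod}^\kappa_{\mathrm{DLO}})^2\mid\mathcal{A}_\eta$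 is embeddable into $\mathcal{A}_\xi\}$. *)

(* Defs.v *)
From HB Require Import structures.
From mathcomp Require Import all_boot all_order finmap.
From mathcomp Require Import boolp wochoice classical_sets functions cardinality.
From mathcomp Require Import filter topology.

Set Implicit Arguments.
Unset Strict Implicit.
Unset Printing Implicit Defensive.

Import Order.TTheory.
Local Open Scope classical_set_scope.
Local Open Scope card_scope.
Local Open Scope order_scope.

Definition card_lt T U (A : set T) (B : set U) : Prop :=
  A #<= B /\ ~ (B #<= A).

(* A cardinal is an initial ordinal: a well-ordered type [K] all of whose
   proper initial segments have smaller cardinality. The elements of [K] are
   the ordinals below kappa, and [below a] is the ordinal [a] as a set. *)
Section Ordinals.
Context {d : Order.disp_t} {K : orderType d}.
Implicit Types (a x y : K) (A C : set K).

Definition below a : set K := [set x | x < a].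

Definition is_cardinal : Prop :=
  well_order (<=%O : rel K) /\
  forall a, card_lt (below a) [set: K].

Definition is_nat_ordinal (n : nat) a : Prop := below a #= `I_n.

Definition cofinal_in a A : Prop :=
  A `<=` below a /\ forall x, x < a -> exists2 y, A y & x <= y.

(* cf(a) is the cardinal of [C] *)
Definition has_cofinality a T (C : set T) : Prop :=
  (exists2 A, cofinal_in a A & A #= C) /\
  (forall A, cofinal_in a A -> C #<= A).

Definition cof_omega : set K := [set a | has_cofinality a [set: nat]].

Definition unbounded C : Prop := forall a, exists2 x, C x & a < x.

Definition limit_point C a : Prop :=
  below a !=set0 /\ forall x, x < a -> exists2 y, C y & x < y < a.

Definition club C : Prop :=
  unbounded C /\ forall a, limit_point C a -> C a.

Definition stationary A : Prop := forall C, club C -> A `&` C !=set0.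

End Ordinals.

Arguments is_cardinal {d} K.
Arguments cof_omega {d} K.

(* The sequences of length less than kappa, with entries in [X]. *)
Definition short_seq d (K : orderType d) (X : Type) : Type :=
  {a : K & {x : K | x < a} -> X}.

(* The set of all functions [K -> X] with the bounded topology; for
   [X = bool] this is the topology that 2^kappa inherits from kappa^kappa. *)
Definition bounded_space d (K : orderType d) (X : Type) : Type := K -> X.

Section BoundedTopology.
Context {d : Order.disp_t} (K : orderType d) (X : Type).

Definition extensions (p : short_seq K X) : set (bounded_space K X) :=
  [set eta | forall x : {x : K | x < projT1 p}, eta (sval x) = projT2 p x].

HB.instance Definition _ := gen_eqMixin (bounded_space K X).
HB.instance Definition _ := gen_choiceMixin (bounded_space K X).
HB.instance Definition _ := @isSubBaseTopological.Build (bounded_space K X)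
  (set (bounded_space K X)) (range extensions) id.

(* The sets [extensions p] form a base, not only a subbase. *)
Lemma nbhs_boundedP (k0 : K) (eta : bounded_space K X)
    (U : set (bounded_space K X)) :
  nbhs eta U <-> exists2 p, extensions p eta & extensions p `<=` U.
Proof.
split=> [|[p peta pU]]; last first.
  exists (extensions p); split=> //; exists [set extensions p].
    move=> _ ->; exists [fset extensions p]%fset.
      by move=> V /fset1P ->; apply/mem_set; exists p.
    by rewrite set_fset1 bigcap_set1.
  by rewrite bigcup_set1.
case=> _ [[I Isub <-] [_ /[dup] /Isub [F Fext <-] IF Feta] IU].
have [a Fa] : exists a : K, forall xi : bounded_space K X,
    (forall x, x < a -> xi x = eta x) -> forall V, V \in enum_fset F -> V xi.
  have: forall V, V \in enum_fset F -> range extensions V /\ V eta.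
    by move=> V VF; split; [exact/set_mem/Fext|exact: Feta].
  elim: (enum_fset F) => [_|V s IHs sP]; first by exists k0.
  have [|a Ha] := IHs; first by move=> W Ws; apply: sP; rewrite in_cons Ws orbT.
  have [[p _ <-] peta] := sP _ (mem_head _ _).
  exists (Order.max a (projT1 p)) => xi xiE W.
  rewrite in_cons => /predU1P[->|]; last first.
    by apply: Ha => x xa; apply: xiE; rewrite lt_max xa.
  by move=> x; rewrite -peta; apply: xiE; rewrite lt_max (svalP x) orbT.
exists (existT _ a (fun x => eta (sval x))) => // xi xip.
apply: IU; exists (\bigcap_(i in [set` F]) id i) => //=.
move=> V VF.
by apply: Fa VF => x xa; exact: (xip (exist _ x xa)).
Qed.

End BoundedTopology.

Notation "2^[ K ]" := (bounded_space K bool)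
  (at level 0, format "2^[ K ]") : type_scope.

Definition sq_omega d (K : orderType d) (eta xi : 2^[K]) : Prop :=
  ~ stationary ((eta @^-1` [set true] `\` xi @^-1` [set true]) `&` cof_omega K).

(* A countable relational vocabulary {P_n | n \in symbols}; the values of
   [arity], and of a structure, outside [symbols] are irrelevant. *)
Record vocabulary := Vocabulary { symbols : set nat; arity : nat -> nat }.

Definition structure (L : vocabulary) (A : Type) : Type :=
  forall n, (arity L n).-tuple A -> Prop.

Definition is_embedding L A B (M : structure L A) (N : structure L B)
    (f : A -> B) : Prop :=
  injective f /\
  forall n (a : (arity L n).-tuple A), symbols L n ->
    M n a <-> N n (map_tuple f a).

Definition embeddable L A B (M : structure L A) (N : structure L B) : Prop :=
  exists f, is_embedding M N f.

(* In [pi (n, a_1, ..., a_k)] the index [n] is the [n]-th element of [K]. *)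
Definition coded_structure L d (K : orderType d) (pi : seq K -> K)
    (eta : 2^[K]) : structure L K :=
  fun n a => exists2 m : K, is_nat_ordinal n m & eta (pi (m :: a)) = true.

(* The vocabulary {<}, with < = P_0. *)
Definition order_vocabulary : vocabulary := Vocabulary [set 0] (fun=> 2).

Definition is_DLO A (M : structure order_vocabulary A) : Prop :=
  let lt x y := M 0 [tuple x; y] in
  [/\ forall x, ~ lt x x,
      forall x y z, lt x y -> lt y z -> lt x z,
      forall x y, [\/ lt x y, x = y | lt y x],
      forall x y, lt x y -> exists2 z, lt x z & lt z y &
      forall x, (exists y, lt y x) /\ (exists y, lt x y)].

Definition Mod_DLO d (K : orderType d) (pi : seq K -> K) : set 2^[K] :=
  [set eta | is_DLO (coded_structure pi eta)].

Definition sq_DLO d (K : orderType d) (pi : seq K -> K)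
    (eta xi : Mod_DLO pi) : Prop :=
  embeddable (coded_structure pi (set_val eta) : structure order_vocabulary K)
             (coded_structure pi (set_val xi)).

Definition continuous_reduction (X Y : topologicalType)
    (E : X -> X -> Prop) (E' : Y -> Y -> Prop) (F : X -> Y) : Prop :=
  continuous F /\ forall x y, E x y <-> E' (F x) (F y).

(* Main.v *)
(* Fix a linear order N on kappa into which every linear order of size < kappa
   embeds, and order kappa * kappa lexicographically by (order of kappa, N); the
   first component is called the rank. The order attached to eta consists of the
   omega-sequences with non-decreasing ranks for which either the ranks attain
   their supremum or eta is 1 at the supremum, ordered lexicographically; every
   point is then replaced by a copy of the rationals.

   Call a point of cofinality omega bad if eta is 1 and xi is 0 there. If a
   club C misses the bad points, replace each entry of a
   sequence f, say with rank in the interval of kappa ending at the next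
   element a of C, by a code in N of the whole part of f of rank < a: fewer
   than kappa such parts exist because lambda^omega < kappa. A supremum of
   ranks that is not a limit of C becomes attained, and the others are in C.

   Conversely let H be (weakly) an embedding, let a be a bad point
   that is closed under suitable functions, and let f have
   rank supremum a. As eta a = 1 but xi a = 0, H f leaves a at some first index
   m. The set of sequences whose image is, on the first m entries, at most H f
   is determined by parameters below a, and f lies above all its members
   bounded below a. By the closure of a, f is the maximum of this set, so its
   ranks are bounded below a, a contradiction. *)
Require Import Defs.
From mathcomp Require Import all_boot all_order all_algebra.
From mathcomp Require Import boolp classical_sets functions cardinality.
From mathcomp Require Import filter topology.

Set Implicit Arguments.
Unset Strict Implicit.
Unset Printing Implicit Defensive.

Import Order.TTheory GRing.Theory Num.Theory.
Local Open Scope classical_set_scope.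
Local Open Scope card_scope.

(** * Strict orders and lexicographic orders *)

Section StrictOrders.
Local Open Scope order_scope.

Definition strict_order T (R : T -> T -> Prop) : Prop :=
  (forall x, ~ R x x) /\ (forall x y z, R x y -> R y z -> R x z).

Definition trichotomous T (R : T -> T -> Prop) : Prop :=
  forall x y, [\/ R x y, x = y | R y x].

Definition prod_lex T U (R : T -> T -> Prop) (S : U -> U -> Prop)
    (x y : T * U) : Prop :=
  R x.1 y.1 \/ (x.1 = y.1 /\ S x.2 y.2).

Definition fun_lex d (I : orderType d) T (R : T -> T -> Prop)
    (f g : I -> T) : Prop :=
  exists i, (forall j, j < i -> f j = g j) /\ R (f i) (g i).

Definition has_least d (I : porderType d) : Prop :=
  forall P : I -> Prop, (exists x, P x) ->
    exists2 x, P x & forall y, P y -> x <= y.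

Lemma has_least_nat : has_least nat.
Proof.
move=> P [x Px]; have exP : exists n, `[< P n >] by exists x; apply/asboolP.
exists (ex_minn exP); case: ex_minnP => m /asboolP Pm mP //.
by move=> y Py; apply: mP; apply/asboolP.
Qed.

Lemma strict_order_lt d (I : orderType d) :
  strict_order (fun x y : I => x < y).
Proof. by split=> [x|x y z]; [rewrite ltxx|exact: lt_trans]. Qed.

Lemma trichotomous_lt d (I : orderType d) :
  trichotomous (fun x y : I => x < y).
Proof. by move=> x y; case: (ltgtP x y); constructor. Qed.

Lemma strict_order_preim T U (h : T -> U) (R : U -> U -> Prop) :
  strict_order R -> strict_order (fun x y => R (h x) (h y)).
Proof. by case=> Rirr Rtr; split=> [x|x y z]; [exact: Rirr|exact: Rtr]. Qed.

Lemma trichotomous_preim T U (h : T -> U) (R : U -> U -> Prop) :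
  injective h -> trichotomous R -> trichotomous (fun x y => R (h x) (h y)).
Proof.
by move=> hinj Rt x y; case: (Rt (h x) (h y)) => [?|/hinj ?|?]; constructor.
Qed.

Section Products.
Context T U (R : T -> T -> Prop) (S : U -> U -> Prop).

Lemma strict_order_prod_lex :
  strict_order R -> strict_order S -> strict_order (prod_lex R S).
Proof.
move=> [Rirr Rtr] [Sirr Str]; split=> [x [/Rirr|[_ /Sirr]]//|].
move=> [x1 x2] [y1 y2] [z1 z2]; rewrite /prod_lex /=.
case=> [Rxy|[-> Sxy]] [Ryz|[<- Syz]].
- by left; apply: Rtr Ryz.
- by left.
- by left.
- by right; split=> //; apply: Str Syz.
Qed.

Lemma trichotomous_prod_lex :
  trichotomous R -> trichotomous S -> trichotomous (prod_lex R S).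
Proof.
move=> Rt St [x1 x2] [y1 y2].
case: (Rt x1 y1) => [?|->|?]; first by constructor 1; left.
  case: (St x2 y2) => [?|->|?]; first by constructor 1; right.
    by constructor 2.
  by constructor 3; right.
by constructor 3; left.
Qed.

End Products.

Section Functions.
Context d (I : orderType d) T (R : T -> T -> Prop).

Lemma strict_order_fun_lex :
  strict_order R -> strict_order (fun_lex R : (I -> T) -> (I -> T) -> Prop).
Proof.
move=> [Rirr Rtr]; split=> [f [i [_ /Rirr]]//|f g h [i [fg Rfg]] [j [gh Rgh]]].
have [ij|ji|ij] := ltgtP i j.
- exists i; split=> [k ki|]; last by rewrite -(gh i ij).
  by rewrite fg // gh // (lt_trans ki).
- exists j; split=> [k kj|]; last by rewrite (fg j ji).
  by rewrite fg ?gh // (lt_trans kj).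
- exists i; split=> [k ki|]; first by rewrite fg ?gh -?ij.
  by rewrite ij in Rfg *; apply: Rtr Rgh.
Qed.

Hypothesis I_least : has_least I.

Lemma first_difference (f g : I -> T) :
  f <> g -> exists2 i, (forall j, j < i -> f j = g j) & f i <> g i.
Proof.
move=> fg; have [|i fgi imin] := I_least (P := fun i => f i <> g i).
  by apply: contrapT => /forallNP fg'; apply/fg/funext => i; exact/notP/fg'.
exists i => // j ji; apply: contrapT => /imin; apply/negP.
by rewrite -ltNge.
Qed.

Lemma trichotomous_fun_lex :
  trichotomous R -> trichotomous (fun_lex R : (I -> T) -> (I -> T) -> Prop).
Proof.
move=> Rt f g; have [->|/first_difference[i fg fgi]] := pselect (f = g).
  by constructor 2.
case: (Rt (f i) (g i)) => [?|//|?]; first by constructor 1; exists i.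
by constructor 3; exists i; split=> // j ji; rewrite fg.
Qed.

(* The values before [i] may already differ, in which case the first
   difference decides. *)
Lemma fun_lex_le (f g : I -> T) i :
  strict_order R -> (forall j, j < i -> R (f j) (g j) \/ f j = g j) ->
  R (f i) (g i) -> fun_lex R f g.
Proof.
move=> [Rirr _] fg fgi.
have [|j eqj neqj] := @first_difference f g.
  by move=> fgE; rewrite fgE in fgi; exact: Rirr fgi.
have [ij|ji|ij] := ltgtP i j.
- by move: fgi; rewrite eqj // => /Rirr.
- by exists j; split=> //; case: (fg j ji).
- by exists j; split=> //; rewrite -ij.
Qed.

End Functions.

End StrictOrders.

Lemma card_le_injP T U (A : set T) (B : set U) : A #<= B ->
  inhabited U ->
  exists2 f : T -> U, (forall x, A x -> B (f x)) &
    (forall x y, A x -> A y -> f x = f y -> x = y).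
Proof.
move=> /card_leP[f] [u].
pose g x := if pselect (A x) is left Ax
            then \val (f (SigSub (mem_set Ax))) else u.
exists g => [x Ax|x y Ax Ay]; rewrite /g; case: pselect => // Ax'.
  by case: (f _) => /= y /set_mem.
case: pselect => // Ay' /val_inj fxy.
have := @inj _ _ _ f _ _ (in_setT _) (in_setT _) fxy.
by move=> /(congr1 \val).
Qed.

Lemma card_le_inj T U (A : set T) (B : set U) (f : T -> U) :
  (forall x, A x -> B (f x)) ->
  (forall x y, A x -> A y -> f x = f y -> x = y) -> A #<= B.
Proof.
move=> fAB finj.
have {}fAB : forall x : A, f (\val x) \in B.
  by move=> [x xA] /=; apply/mem_set/fAB/set_mem.
pose g (x : A) : B := SigSub (fAB x).
have ginj : set_inj [set: A] g.
  move=> x y _ _ /(congr1 \val) /= fxy; apply: val_inj; apply: finj fxy.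
    by apply: set_mem; case: x.
  by apply: set_mem; case: y.
by apply/card_leP/injfunPex; exists g.
Qed.

(** * Sets of size less than $\kappa$ *)

Section Small.
Context {d : Order.disp_t} {K : orderType d}.
Local Open Scope order_scope.

(** The injection into a segment is kept as a witness: it indexes [L] by ordinals below [a], so that
    short sequences can code functions on [L]. *)
Definition small (L : Type) : Prop :=
  exists (a : K) (j : L -> K), injective j /\ forall x, j x < a.

Lemma small_inj L L' (f : L -> L') : injective f -> small L' -> small L.
Proof.
move=> finj [a [j [jinj ja]]]; exists a, (j \o f).
by split=> [x y /jinj/finj|x] //=; exact: ja.
Qed.

Hypothesis K_cardinal : is_cardinal K.
Hypothesis K_uncountable : ~ countable [set: K].

Lemma cardinal_has_least : has_least K.
Proof.
move=> P [x Px]; have [wo _] := K_cardinal.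
have [|z [[zP zmin] _]] := wo (mem [set x | P x]).
  by exists x; apply/mem_set.
exists z; first exact: (set_mem zP).
by move=> y Py; apply: zmin; apply/mem_set.
Qed.

Lemma cardinal_nonempty : inhabited K.
Proof.
apply: contrapT => K0; apply: K_uncountable.
have -> : [set: K] = set0 by rewrite -subset0 => x _; apply: K0.
exact: countable0.
Qed.

Lemma cardinal_lt_wf : well_founded (fun x y : K => x < y).
Proof.
move=> a; apply: contrapT => na.
have [|b nb bmin] :=
  @cardinal_has_least (fun a => ~ Acc (fun x y : K => x < y) a).
  by exists a.
apply: nb; constructor=> c cb; apply: contrapT => /bmin.
by rewrite leNgt cb.
Qed.

Lemma no_injection_of_small (L : Type) (f : K -> L) :
  small L -> injective f -> False.
Proof.
move=> [a [j [jinj ja]]] finj; have [_ /(_ a)[_]] := K_cardinal; apply.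
apply: (@card_le_inj _ _ _ _ (j \o f)) => [x _|x y _ _ /jinj/finj//].
exact: ja.
Qed.

(** Recursion along [K] lists new elements of [L] while there are any, and then repeats [l0]. If new
    ones never run out, [K] injects into [L]; otherwise some proper segment lists all of [L]. *)
Lemma card_lt_small L : card_lt [set: L] [set: K] -> small L.
Proof.
move=> [_ KL]; have [k0] := cardinal_nonempty.
have [[l0]|L0] := pselect (inhabited L); last first.
  have nl : forall l : L, False by move=> l; apply: L0.
  by exists k0, (fun=> k0); split=> l; case: (nl l).
pose step (x : K) (c : forall y : K, y < x -> L) : L :=
  if pselect (exists l, forall (y : K) (yx : y < x), c y yx <> l) is left e
  then projT1 (cid e) else l0.
pose c := Fix cardinal_lt_wf (fun=> L) step.
have cE x : c x = step x (fun y _ => c y).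
  rewrite /c Fix_eq // => y f g fg.
  congr (step y _); apply: functional_extensionality_dep => u.
  apply/funext => v.
  exact: fg.
have [all_new|] := pselect (forall x, exists l, forall y, y < x -> c y <> l).
  case: KL; apply: (@card_le_inj _ _ _ _ c) => // x y _ _.
  have cnew u v : u < v -> c u <> c v.
    rewrite (cE v) /step => uv; case: pselect => [e|/(_ (all_new v))//].
    by case: (cid e) => l /= /(_ u uv).
  by case: (ltgtP x y) => [/cnew|/cnew + /esym|].
move=> /existsNP[a /forallNP a_all].
have {}a_all l : exists y, y < a /\ c y = l.
  by have /existsNP[y /not_implyP[ya /contrapT cy]] := a_all l; exists y.
pose j l := projT1 (cid (a_all l)).
have jP l : j l < a /\ c (j l) = l by exact: projT2 (cid (a_all l)).
exists a, j; split=> [l l' jl|l]; last by have [] := jP l.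
by have [_ <-] := jP l; have [_ <-] := jP l'; rewrite jl.
Qed.

Lemma small_card_lt L : small L -> card_lt [set: L] [set: K].
Proof.
move=> Lsm; split.
  have [a [j [jinj _]]] := Lsm.
  by apply: (@card_le_inj _ _ _ _ j) => // x y _ _ /jinj.
move=> KL; have [k0] := cardinal_nonempty.
have [l0] : inhabited L.
  by have /card_leP[f] := KL; exists; exact: \val (f (SigSub (in_setT k0))).
have [|f _ finj] := card_le_injP KL; first by constructor.
by apply: (no_injection_of_small Lsm (f := f)) => x y; exact: finj.
Qed.

Lemma small_nat : small nat.
Proof.
apply: card_lt_small; split; last exact: K_uncountable.
by apply/infiniteP => /finite_set_countable/K_uncountable.
Qed.

Lemma nat_inj : exists v : nat -> K, injective v.
Proof. by have [a [v [vinj _]]] := small_nat; exists v. Qed.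

(** Removing one point from an infinite set keeps its cardinality, so below a maximum there would be
    as many points as in [K]. *)
Lemma cardinal_nomax (a : K) : exists b, a < b.
Proof.
apply: contrapT => /forallNP a_max.
have {}a_max x : x <= a by rewrite leNgt; apply/negP/a_max.
have [v vinj] := nat_inj.
have vna : exists w : nat -> K, injective w /\ forall n, w n < a.
  have [[m vma]|nva] := pselect (exists m, v m = a); last first.
    exists v; split=> // n; rewrite lt_neqAle a_max andbT.
    by apply/eqP => vn; apply: nva; exists n.
  exists (fun n => v (m + n.+1)%N); split=> [x y /vinj /addnI[]//|n].
  rewrite lt_neqAle a_max andbT -vma; apply/eqP => /vinj.
  by move/eqP; rewrite -[X in _ == X]addn0 eqn_add2l.
have [w [winj wa]] := vna.
(* Hilbert's hotel: free the place [w 0] for the maximum. *)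
pose h x := if x == a then w 0 else
  if pselect (exists n, w n = x) is left e then w (projT1 (cid e)).+1 else x.
have ha : h a = w 0 by rewrite /h eqxx.
have hw n : h (w n) = w n.+1.
  rewrite /h (negbTE (_ : w n != a)); last by rewrite neq_lt wa.
  by case: pselect => [e|[]]; [case: (cid e) => m /= /winj ->|exists n].
have hx x : x <> a -> (forall n, w n <> x) -> h x = x.
  move=> /eqP/negbTE xa xw; rewrite /h xa.
  by case: pselect => // -[n wn]; case: (xw n).
have cases x : [\/ x = a, exists n, x = w n | x <> a /\ forall n, w n <> x].
  have [->|xa] := pselect (x = a); first by constructor 1.
  have [[n ->]|xw] := pselect (exists n, x = w n).
    by constructor 2; exists n.
  by constructor 3; split=> // n wn; apply: xw; exists n.
have [_ /(_ a)[_]] := K_cardinal; apply.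
apply: (@card_le_inj _ _ _ _ h) => [x _|x y _ _].
  rewrite /below /=; case: (cases x) => [->|[n ->]|[xa xw]].
  - by rewrite ha.
  - by rewrite hw.
  - by rewrite hx // lt_neqAle a_max andbT; apply/eqP.
case: (cases x) (cases y) => [->|[n ->]|[xa xw]] [->|[m ->]|[ya yw]];
  rewrite ?ha ?hw ?(hx x xa xw) ?(hx y ya yw) //.
- by move=> /winj.
- by move=> /yw.
- by move=> /winj.
- by move=> /winj[->].
- by move=> /yw.
- by move=> /esym/xw.
- by move=> /esym/xw.
Qed.

Lemma small_segment (a : K) : small {x : K | x <= a}.
Proof.
have [b ab] := cardinal_nomax a.
exists b, sval; split=> [x y|[x xa] /=]; first exact: val_inj.
exact: le_lt_trans ab.
Qed.

(** * Regularity of $\kappa$ and the universal order *)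

Hypothesis K_exp : [set: short_seq K K] #= [set: K].

Definition seq_value (k0 : K) (p : short_seq K K) (z : K) : K :=
  if pselect (z < projT1 p) is left zp then projT2 p (exist _ z zp) else k0.

(** This is the form in which $\kappa^{<\kappa}=\kappa$ is used. Padding by [k0] turns short
    sequences of all lengths into total functions. *)
Lemma short_seq_enum (k0 : K) : exists e : K -> K -> K,
  forall (a : K) (h : K -> K),
    exists y, e y = fun z => if z < a then h z else k0.
Proof.
have [g gK] : exists g : K -> short_seq K K, forall p, exists y, g y = p.
  have /card_bijP[f [g fK gK]] := K_exp.
  exists (fun y => \val (g (SigSub (in_setT y)))) => p.
  exists (\val (f (SigSub (in_setT p)))).
  set q := f _; have -> : SigSub (in_setT (\val q)) = q by exact: val_inj.
  by rewrite /q fK.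
exists (fun y => seq_value k0 (g y)) => a h.
have [y gy] := gK (existT _ a (fun x => h (sval x))).
exists y; apply/funext => z; rewrite gy /seq_value /=.
by case: pselect => [->//|/negP/negbTE ->].
Qed.

(** Regularity of $\kappa$, by a diagonal argument as in König's theorem: if [g] were unbounded, a
    sequence that at place [j x] avoids [e y] for all [y <= g x] would be missing from the
    enumeration [e]. *)
Lemma small_bounded L (g : L -> K) : small L -> exists b, forall x, g x < b.
Proof.
move=> [a [j [jinj ja]]]; apply: contrapT => /forallNP g_unb.
have {}g_unb b : exists x, b <= g x.
  by have /existsNP[x /negP] := g_unb b; rewrite -leNgt; exists x.
have [k0] := cardinal_nonempty; have [e eP] := short_seq_enum k0.
(* The values to avoid at [j x] come from a small segment, so they do not exhaust [K]. *)
have h_ex x : exists u, forall y, y <= g x -> e y (j x) <> u.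
  apply: contrapT => /forallNP all_u.
  have {}all_u u : exists y, y <= g x /\ e y (j x) = u.
    by have /existsNP[y /not_implyP[? /contrapT ?]] := all_u u; exists y.
  pose c u : {y | y <= g x} :=
    exist _ (projT1 (cid (all_u u))) (proj1 (projT2 (cid (all_u u)))).
  apply: (no_injection_of_small (small_segment (g x)) (f := c)) => u v.
  move=> /(congr1 val) /= cuv.
  have [_ <-] := projT2 (cid (all_u u)); have [_ <-] := projT2 (cid (all_u v)).
  exact: (congr1 (e^~ _) cuv).
pose h x := projT1 (cid (h_ex x)).
have hP x y : y <= g x -> e y (j x) <> h x.
  by rewrite /h; case: (cid _) => u /= /(_ y).
have [y yE] := eP a (fun z => if pselect (exists x, j x = z) is left x
                              then h (projT1 (cid x)) else k0).
have [x /hP] := g_unb y; apply; rewrite yE ja.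
case: pselect => [ex|[]]; last by exists x.
by case: (cid ex) => x' /= /jinj ->.
Qed.

Hypothesis K_omega : forall L : Type,
  card_lt [set: L] [set: K] -> card_lt [set: nat -> L] [set: K].

Lemma small_sequences L : small L -> small (nat -> L).
Proof. by move=> Lsm; apply/card_lt_small/K_omega/small_card_lt. Qed.

(** A pair is read as the sequence [x, x', x', ...] in a common segment, which reduces products to
    $\lambda^\omega<\kappa$. *)
Lemma small_prod L L' : small L -> small L' -> small (L * L').
Proof.
move=> [a [j [jinj ja]]] [b [j' [jinj' jb]]].
have seq_sm := small_sequences (small_segment (Order.max a b)).
have le1 x : j x <= Order.max a b by rewrite le_max ltW.
have le2 x : j' x <= Order.max a b by rewrite le_max (ltW (jb x)) orbT.
pose f (x : L * L') (n : nat) : {z | z <= Order.max a b} :=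
  if n is 0 then exist _ (j x.1) (le1 x.1) else exist _ (j' x.2) (le2 x.2).
apply: (small_inj (f := f)) seq_sm => -[x x'] [y y'] fxy.
have /(congr1 val)/= /jinj -> := congr1 (@^~ 0%N) fxy.
by have /(congr1 val)/= /jinj' -> := congr1 (@^~ 1%N) fxy.
Qed.


(** Points are compared lexicographically as functions through [e], and then by themselves, since
    [e] may repeat functions. A small order embeds by sending [y] to the characteristic function of
    its [R]-predecessors: for [R x y] this function grows by transitivity, and strictly so at
    [j x]. *)
Lemma universal_order : exists N : K -> K -> Prop,
  [/\ strict_order N, trichotomous N &
    forall L (R : L -> L -> Prop), small L -> strict_order R ->
      exists i : L -> K, forall x y, R x y -> N (i x) (i y)].
Proof.
have [k0] := cardinal_nonempty; have [k1 k01] := cardinal_nomax k0.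
have [e eP] := short_seq_enum k0; have K_least := cardinal_has_least.
pose lt (x y : K) : Prop := x < y.
have lt_strict : strict_order lt by exact: strict_order_lt.
have lt_tri : trichotomous lt by exact: trichotomous_lt.
pose N0 := prod_lex (fun_lex lt : (K -> K) -> (K -> K) -> Prop) lt.
exists (fun x y => N0 (e x, x) (e y, y)); split.
- apply: (@strict_order_preim _ _ (fun x => (e x, x))).
  by apply: strict_order_prod_lex => //; exact: strict_order_fun_lex.
- apply: (@trichotomous_preim _ _ (fun x => (e x, x))); first by move=> x y [].
  by apply: trichotomous_prod_lex => //; exact: trichotomous_fun_lex.
move=> L R [a [j [jinj ja]]] [Rirr Rtr].
pose s (y : L) (z : K) :=
  if `[< exists y', j y' = z /\ R y' y >] then k1 else k0.
have sE y : exists x, e x = s y.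
  have [x ex] := eP a (s y); exists x; rewrite ex; apply/funext => z.
  case: ifP => // za.
  rewrite /s; case: asboolP => // -[y' [jz _]]; move: za; rewrite -jz.
  by rewrite ja.
have {sE}[i iE] := choice sE.
exists i => x y Rxy; left => /=; rewrite !iE.
apply: (fun_lex_le K_least (i := j x)) => // [z _|].
  rewrite /s; case: asboolP => [[y' [jy' Ry'x]]|_].
    by case: asboolP => [_|[]]; [right|exists y'; split=> //; apply: Rtr Rxy].
  by case: asboolP; [left|right].
rewrite /s /lt; case: asboolP => [[y' [/jinj -> /Rirr//]]|_].
by case: asboolP => // -[]; exists x.
Qed.

Lemma seq_sup (x : nat -> K) : exists a,
  (forall n, x n < a) /\ forall y, y < a -> exists n, y <= x n.
Proof.
have [|a xa amin] := cardinal_has_least (P := fun a => forall n, x n < a).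
  exact: small_bounded small_nat.
exists a; split=> // y ya; apply: contrapT => /forallNP xy.
have /amin : forall n, x n < y by move=> n; rewrite ltNge; apply/negP.
by rewrite leNgt ya.
Qed.

(** * Clubs and cofinality $\omega$ *)

Lemma club_setT : club [set: K].
Proof. by split=> // a; have [b ab] := cardinal_nomax a; exists b. Qed.

(** For unboundedness, iterate $\omega$ times a step to a point of [C] above all [g y] with
    [y <= u], which exists by regularity. The supremum is closed under [g]. *)
Lemma club_closed_under (C : set K) (g : K -> K) : club C ->
  club [set a | C a /\ forall x, x < a -> g x < a].
Proof.
move=> [Cunb Ccl]; split=> [a|a [a0 alim]]; last first.
  split=> [|x /alim[y [_ yg] /andP[xy ya]]]; last exact: lt_trans (yg _ xy) ya.
  apply: Ccl; split=> // x /alim[y [Cy _] xya]; exact: ex_intro2 _ _ y Cy xya.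
have next_ex u : exists v, [/\ C v, u < v & forall y, y <= u -> g y < v].
  have [b gb] := small_bounded (fun y : {y | y <= u} => g (sval y))
    (small_segment u).
  have [v Cv] := Cunb (Order.max u b); rewrite gt_max => /andP[uv bv].
  by exists v; split=> // y yu; exact: lt_trans (gb (exist _ y yu)) bv.
have [next nextP] := choice next_ex.
pose x n := iter n next a.
have [b [xb bx]] := seq_sup x.
exists b; last exact: (xb 0).
split=> [|y /bx[n yx]]; last first.
  have [_ _ /(_ _ yx) gy] := nextP (x n).
  exact: lt_trans gy (xb n.+1).
apply: Ccl; split=> [|y /bx[n yx]]; first by exists a; exact: (xb 0).
have [Cx xx _] := nextP (x n); exists (x n.+1) => //.
by rewrite (xb n.+1) andbT; exact: le_lt_trans xx.
Qed.

(** As no [x n] is largest, any set cofinal in [a] contains a strictly increasing $\omega$-sequence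
    and is therefore infinite. *)
Lemma cof_omega_sup (x : nat -> K) (a : K) : (forall n, x n < a) ->
  (forall y, y < a -> exists n, y < x n) -> cof_omega K a.
Proof.
move=> xa ax.
have inf A : cofinal_in a A -> [set: nat] #<= A.
  move=> [Aa Acof].
  have next_ex u : exists v, u < a -> A v /\ u < v.
    have [ua|] := boolP (u < a); last by exists u.
    have [n ux] := ax u ua; have [v Av xv] := Acof _ (xa n).
    by exists v => _; split=> //; exact: lt_le_trans xv.
  have [next nextP] := choice next_ex.
  pose y n := iter n next (x 0).
  have ya n : y n < a.
    by elim: n => //= n /nextP[/Aa].
  have ylt : {homo y : m n / (m < n)%N >-> m < n}.
    apply: homo_ltn; first exact: lt_trans.
    by move=> n; have [] := nextP _ (ya n).
  (* The shift skips [y 0 = x 0], which need not lie in [A]. *)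
  apply: (@card_le_inj _ _ _ _ (y \o S)) => /= [n _|m n _ _].
    by have [] := nextP _ (ya n).
  have ylt' u v : (u < v)%N -> y u.+1 <> y v.+1.
    by move=> uv /eqP; rewrite (lt_eqF (ylt u.+1 v.+1 uv)).
  by case: (ltngtP m n) => // mn yy; [case: (ylt' _ _ mn)|case: (ylt' _ _ mn)].
split=> //; exists (range x).
  split=> [_ [n _ <-]|y /ax[n yx]]; first exact: xa.
  by exists (x n) => //; exact: ltW.
rewrite card_eq_le; apply/andP; split; first exact: card_image_le.
apply: inf; split=> [_ [n _ <-]|y /ax[n yx]]; first exact: xa.
by exists (x n) => //; exact: ltW.
Qed.

Lemma cof_omega_seq (a : K) : cof_omega K a -> exists x : nat -> K,
  [/\ forall n, x n < a, forall n, x n <= x n.+1 &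
      forall y, y < a -> exists n, y <= x n].
Proof.
move=> [[A [Aa Acof] /card_bijP[f [g fK _]]] _].
pose y n := \val (g (SigSub (in_setT n))).
pose x := fix x n := if n is m.+1 then Order.max (x m) (y n) else y 0.
have ya n : y n < a by apply/Aa/set_mem; rewrite /y; case: (g _).
have yx n : y n <= x n by case: n => //= n; rewrite le_max lexx orbT.
exists x; split=> [n|n|z /Acof[u Au zu]].
- by elim: n => [|n IHn] /=; rewrite ?gt_max ?IHn ya.
- by rewrite /= le_max lexx.
- exists (\val (f (SigSub (mem_set Au)))); apply: le_trans (yx _).
  rewrite /y; set q := f _.
  have -> : SigSub (in_setT (\val q)) = q by exact: val_inj.
  by rewrite /q fK.
Qed.

Lemma small_box (a : K) : small (nat -> {x : K | x <= a} * {x : K | x <= a}).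
Proof. by apply/small_sequences/small_prod; exact: small_segment. Qed.

End Small.

(** * Ranked sequences *)

Section RankedSequences.
Context {d : Order.disp_t} {K : orderType d}.
Local Open Scope order_scope.

Definition ranked_seq := nat -> K * K.

Implicit Types (f g s t : ranked_seq) (eta xi : 2^[K]).

Definition seq_lt (N : K -> K -> Prop) : ranked_seq -> ranked_seq -> Prop :=
  fun_lex (prod_lex (fun x y : K => x < y) N).

Definition boxed (a : K) f : Prop := forall n, (f n).1 <= a /\ (f n).2 <= a.

(** Keeping second components at most the ranks makes a bound on the ranks a bound on the whole
    sequence, and fewer than $\kappa$ sequences obey a given bound. *)
Definition rank_monotone f : Prop :=
  forall n, (f n).2 <= (f n).1 /\ (f n).1 <= (f n.+1).1.

(** The least strict upper bound: the supremum if it is not attained, and the successor of the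
    maximum otherwise. *)
Definition rank_sup f (a : K) : Prop :=
  (forall n, (f n).1 < a) /\ forall x, x < a -> exists n, x <= (f n).1.

Definition admissible eta f : Prop :=
  rank_monotone f /\
  ((exists m, forall n, (f n).1 <= (f m).1) \/
   exists2 a, rank_sup f a & eta a = true).

Lemma rank_homo f m n : rank_monotone f -> (m <= n)%N -> (f m).1 <= (f n).1.
Proof.
move=> fmon /subnKC <-; elim: (n - m)%N => [|k IHk]; first by rewrite addn0.
by rewrite addnS (le_trans IHk)//; have [] := fmon (m + k)%N.
Qed.

Lemma rank_sup_unique f a b : rank_sup f a -> rank_sup f b -> a = b.
Proof.
move=> [fa af] [fb bf]; case: (ltgtP a b) => // [/bf|/af] [n].
  by rewrite leNgt fa.
by rewrite leNgt fb.
Qed.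

Hypothesis K_cardinal : is_cardinal K.
Hypothesis K_uncountable : ~ countable [set: K].
Hypothesis K_exp : [set: short_seq K K] #= [set: K].
Hypothesis K_omega : forall L : Type,
  card_lt [set: L] [set: K] -> card_lt [set: nat -> L] [set: K].

(** Presents boxed sequences by elements of a small type, so that regularity and the universality of
    [N] apply to them. *)
Lemma boxed_retract (a : K) :
  exists h : ranked_seq -> nat -> {x : K | x <= a} * {x : K | x <= a},
  forall f, boxed a f -> (fun n => (sval (h f n).1, sval (h f n).2)) = f.
Proof.
pose v (x : K) : {x : K | x <= a} :=
  if boolP (x <= a) is AltTrue xa then exist _ x xa else exist _ a (lexx a).
have vE x : x <= a -> sval (v x) = x.
  by move=> xa; rewrite /v; case: {-}_ / boolP => //; rewrite xa.
exists (fun f n => (v (f n).1, v (f n).2)) => f fa; apply/funext => n.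
by have [f1 f2] := fa n; rewrite !vE //; case: (f n).
Qed.

Lemma boxed_bounded (a : K) (phi : ranked_seq -> K) :
  exists b, forall f, boxed a f -> phi f < b.
Proof.
have [h hK] := boxed_retract a.
have [b phib] := small_bounded K_cardinal K_uncountable K_exp
  (fun y => phi (fun n => (sval (y n).1, sval (y n).2)))
  (small_box K_cardinal K_uncountable K_omega a).
by exists b => f /hK {1}<-; exact: phib.
Qed.

Lemma nat_bounded (phi : nat -> K) : exists b, forall n, phi n < b.
Proof.
by apply: (small_bounded K_cardinal K_uncountable K_exp); exact: small_nat.
Qed.

(** * From a club to an embedding *)

Section Embeddings.
Variable N : K -> K -> Prop.
Hypothesis N_strict : strict_order N.
Hypothesis N_tri : trichotomous N.
Hypothesis N_universal : forall L (R : L -> L -> Prop),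
  @small d K L -> strict_order R ->
  exists i : L -> K, forall x y, R x y -> N (i x) (i y).

Local Notation entry_lt := (prod_lex (fun x y : K => x < y) N).

Lemma strict_order_entry_lt : strict_order entry_lt.
Proof. exact: strict_order_prod_lex (strict_order_lt _) N_strict. Qed.

Lemma strict_order_seq_lt : strict_order (seq_lt N).
Proof. exact: strict_order_fun_lex strict_order_entry_lt. Qed.

Lemma trichotomous_seq_lt : trichotomous (seq_lt N).
Proof.
apply: trichotomous_fun_lex; first exact: has_least_nat.
by apply: trichotomous_prod_lex; [exact: trichotomous_lt|exact: N_tri].
Qed.

Lemma boxed_embed (a : K) : exists (i : ranked_seq -> K) (b : K),
  (forall f g, boxed a f -> boxed a g -> seq_lt N f g -> N (i f) (i g)) /\
  forall f, i f < b.
Proof.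
have [h hK] := boxed_retract a.
have sm := small_box K_cardinal K_uncountable K_omega a.
pose v (y : nat -> {x : K | x <= a} * {x : K | x <= a}) : ranked_seq :=
  fun n => (sval (y n).1, sval (y n).2).
have [i iP] := N_universal sm (strict_order_preim v strict_order_seq_lt).
have [b ib] := small_bounded K_cardinal K_uncountable K_exp i sm.
exists (i \o h), b; split=> [f g fa ga fg|f]; last exact: ib.
by apply: iP; rewrite /v !hK.
Qed.

(** The part of [f] of rank below [a]; the filler [(a, a)] is above every entry that is kept. *)
Definition cap_ranks (a : K) f : ranked_seq :=
  fun n => if (f n).1 < a then f n else (a, a).

Lemma boxed_cap_ranks (a : K) f : rank_monotone f -> boxed a (cap_ranks a f).
Proof.
move=> fmon n; rewrite /cap_ranks; case: ifP => // fa.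
by have [f21 _] := fmon n; split; [exact: ltW|exact/ltW/(le_lt_trans f21)].
Qed.

(** If [f n] has rank at least [a], so do all later entries of [f] and [g], and the capped sequences
    coincide. Otherwise [f n] is kept, and [g n] is kept or raised to [(a, a)]. *)
Lemma cap_ranks_le (a : K) f g n :
  rank_monotone f -> rank_monotone g -> (forall m, (m < n)%N -> f m = g m) ->
  entry_lt (f n) (g n) ->
  (cap_ranks a f = cap_ranks a g \/ seq_lt N (cap_ranks a f) (cap_ranks a g)) /\
  ((f n).1 < a -> seq_lt N (cap_ranks a f) (cap_ranks a g)).
Proof.
move=> fmon gmon fg fgn.
have capE m : (m < n)%N -> cap_ranks a f m = cap_ranks a g m.
  by move=> /fg; rewrite /cap_ranks => ->.
have lt_a : (f n).1 < a -> seq_lt N (cap_ranks a f) (cap_ranks a g).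
  move=> fa; exists n; split=> //; rewrite /cap_ranks fa; case: ifP => // ga.
  by left.
split=> //; have [/lt_a ?|af] := ltP (f n).1 a; first by right.
left; apply/funext => m; have [/capE//|nm] := ltnP m n.
have fgn1 : (f n).1 <= (g n).1 by case: fgn => [/ltW|[->]].
rewrite /cap_ranks !ifN // -leNgt.
  exact/(le_trans af)/(le_trans fgn1)/rank_homo.
exact/(le_trans af)/rank_homo.
Qed.

(** Entry [n] of [e f] codes all of [f] below the next club point, including later entries. So [e f]
    and [e g] may differ before [f] and [g] do, but only in the right direction. *)
Lemma admissible_embed eta xi (C : set K) : club C ->
  (forall a, C a -> cof_omega K a -> eta a = true -> xi a = true) ->
  exists e : ranked_seq -> ranked_seq,
    (forall f, admissible eta f -> admissible xi (e f)) /\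
    (forall f g, admissible eta f -> admissible eta g ->
       seq_lt N f g -> seq_lt N (e f) (e g)).
Proof.
move=> C_club C_sub.
have [i /choice[b0 ib]] := choice boxed_embed.
(* Using [B] for the new ranks keeps them above the codes, as [rank_monotone] demands; closure under
   [B] makes [B] strictly increasing on [C']. *)
pose B a := Order.max a (b0 a).
have [C'_unb C'_lim] :=
  club_closed_under K_cardinal K_uncountable K_exp B C_club.
set C' := [set a | _] in C'_unb C'_lim.
have c_ex x : exists a, [/\ C' a, x < a & forall y, C' y -> x < y -> a <= y].
  have [|a [Ca xa] amin] := cardinal_has_least K_cardinal
    (P := fun a => C' a /\ x < a); first by have [a] := C'_unb x; exists a.
  by exists a; split=> // y C'y xy; apply: amin.
have [c cP] := choice c_ex.
have c_le x y : x <= y -> c x <= c y.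
  move=> xy; have [_ _ cmin] := cP x; have [C'y yc _] := cP y.
  by apply: cmin => //; exact: le_lt_trans yc.
have B_lt x y : c x < c y -> B (c x) < B (c y).
  move=> cxy; have [[_ /(_ _ cxy) cB] _ _] := cP y.
  by apply: (lt_le_trans cB); rewrite le_max lexx.
have B_le x y : x <= y -> B (c x) <= B (c y).
  by move=> /c_le; rewrite le_eqVlt => /predU1P[->//|/B_lt/ltW].
pose e f : ranked_seq :=
  fun n => (B (c (f n).1), i (c (f n).1) (cap_ranks (c (f n).1) f)).
have e_mon f : rank_monotone f -> rank_monotone (e f).
  move=> fmon n; split; last by apply: B_le; have [] := fmon n.
  by rewrite /= le_max (ltW ((ib _).2 _)) orbT.
exists e; split=> [f [fmon fsup]|]; last first.
  move=> f g [fmon _] [gmon _] [n [fg fgn]].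
  apply: (fun_lex_le has_least_nat (i := n)) => [|m mn|].
  - exact: strict_order_entry_lt.
  - rewrite /e (fg m mn); set a := c _.
    have [[->|lt_cap] _] := cap_ranks_le a fmon gmon fg fgn; first by right.
    by left; right; split=> //; apply: (ib a).1 => //; exact: boxed_cap_ranks.
  - have fgn1 : (f n).1 <= (g n).1 by case: fgn => [/ltW|[->]].
    move: (c_le _ _ fgn1); rewrite le_eqVlt => /predU1P[cE|/B_lt]; last by left.
    right; split; rewrite /= cE //.
    have [_ lt_cap] := cap_ranks_le (c (g n).1) fmon gmon fg fgn.
    apply: (ib _).1; [exact: boxed_cap_ranks|exact: boxed_cap_ranks|].
    by apply: lt_cap; rewrite -cE; have [] := cP (f n).1.
split; first exact: e_mon.
have [[m fm]|/forallNP natt] :=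
  pselect (exists m, forall n, c (f n).1 <= c (f m).1).
  left; exists m => n; move: (fm n).
  by rewrite /= le_eqVlt => /predU1P[->//|/B_lt/ltW].
have {}natt m : exists n, c (f m).1 < c (f n).1.
  have /existsNP[n /negP] := natt m; rewrite -ltNge; by exists n.
case: fsup => [[m fm]|[a [fa af] etaa]].
  by have [n] := natt m; rewrite ltNge c_le.
(* Otherwise [c (f n).1] would be a point of [C'] above all ranks of [f], and no [c (f k).1] could
   exceed it. *)
have ca n : c (f n).1 < a.
  have [k] := natt n; apply: contraTT; rewrite -!leNgt => ac.
  have [_ _] := cP (f k).1; apply; first by have [] := cP (f n).1.
  exact: lt_le_trans (fa k) ac.
have C'a : C' a.
  apply: C'_lim; split=> [|x /af[n xf]]; first by exists (f 0).1; exact: fa.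
  have [C'c fc _] := cP (f n).1; exists (c (f n).1) => //.
  by rewrite ca andbT; exact: le_lt_trans fc.
right; exists a.
  split=> [n|x /af[n xf]]; first by have [_ /(_ _ (ca n))] := C'a.
  exists n; apply: (le_trans xf); rewrite le_max; apply/orP; left; apply: ltW.
  by have [] := cP (f n).1.
have [Ca _] := C'a; apply: C_sub => //.
apply: (cof_omega_sup (x := fun n => (f n).1)) => // y /af[n yf].
have [k cnk] := natt n; exists k; apply: (le_lt_trans yf).
by rewrite ltNge; apply: contraTN cnk => /c_le; rewrite -leNgt.
Qed.


(** * From an embedding to a club *)

Lemma finite_bound (a b : K) (m : nat) (h : nat -> K) :
  b < a -> (forall i, (i < m)%N -> h i < a) ->
  exists c, [/\ c < a, b <= c & forall i, (i < m)%N -> h i <= c].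
Proof.
move=> ba; elim: m => [|m IHm] ha; first by exists b.
have [i im|c [ca bc hc]] := IHm; first by apply: ha; exact: ltnW.
exists (Order.max c (h m)); split=> [||i].
- by rewrite gt_max ca ha.
- by rewrite le_max bc.
- rewrite ltnS leq_eqVlt le_max => /predU1P[->|/hc ->//].
  by rewrite lexx orbT.
Qed.

(** [H] will be an embedding of the orders with rationals, restricted to one point per sequence and
    stripped of the other coordinates. This may identify sequences, hence weak monotonicity and the
    bound on fibres. *)
Lemma no_admissible_embedding eta xi (H : ranked_seq -> ranked_seq) :
  (forall f, admissible eta f -> admissible xi (H f)) ->
  (forall f g, admissible eta f -> admissible eta g ->
     seq_lt N f g -> seq_lt N (H f) (H g) \/ H f = H g) ->
  (forall g, exists b, forall f, admissible eta f -> H f = g ->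
     forall n, (f n).1 < b) ->
  sq_omega eta xi.
Proof.
move=> H_adm H_le H_fib stat.
have [seq_irr seq_tr] := strict_order_seq_lt.
have [r rP] := choice (fun f => nat_bounded (fun n => (f n).1)).
have [fib fibP] := choice H_fib.
(* [A s m]: the first [m] entries of [H f] are lexicographically at most those of [s]. *)
pose A s m f := admissible eta f /\ ~ exists i, [/\ (i < m)%N,
  forall j, (j < i)%N -> s j = H f j & entry_lt (s i) (H f i)].
(* Only the entries of [t] up to [n] matter here, so a sequence can later be replaced by a
   truncation. *)
pose W s m t n f := [/\ A s m f, forall j, (j < n)%N -> f j = t j &
  entry_lt (t n) (f n)].
pose top s m f := A s m f /\ forall g, A s m g -> g = f \/ seq_lt N g f.
have W_ex (x : ranked_seq * nat * ranked_seq * nat) : exists b,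
    let: (s, m, t, n) := x in
    (exists f, W s m t n f) -> exists2 f, W s m t n f & forall k, (f k).1 < b.
  case: x => [[[s m] t] n].
  have [[f Wf]|nW] := pselect (exists f, W s m t n f); last by exists (s 0).1.
  by exists (r f) => _; exists f.
have [w /(_ (_, _, _, _)) wP] := choice W_ex.
(* A maximum is unique, so the bound for one serves for all. *)
have top_ex (x : ranked_seq * nat) : exists b,
    forall f, top x.1 x.2 f -> forall k, (f k).1 < b.
  have [[f [Af fmax]]|ntop] := pselect (exists f, top x.1 x.2 f); last first.
    by exists (x.1 0).1 => f fP; case: ntop; exists f.
  exists (r f) => g [Ag gmax]; case: (fmax g Ag) => [->//|gf].
  case: (gmax f Af) => [->//|fg].
  by case: (seq_irr f); exact: seq_tr fg gf.
have [v /(_ (_, _)) vP] := choice top_ex.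
have [bn bnP] := choice nat_bounded.
have bb_ex (x : K * (ranked_seq -> K)) : exists b,
    forall f, boxed x.1 f -> x.2 f < b by exact: boxed_bounded.
have [bb /(_ (_, _)) bbP] := choice bb_ex.
(* [G0] collects the bounds needed for given parameters, and [G a] exceeds them for all [s] and [t]
   boxed by [a]. If [a] is closed under [G], parameters boxed below [a] have their bounds below
   [a]. *)
pose G0 s t m n := Order.max (Order.max (r (H s)) (fib s))
  (Order.max (w (s, m, t, n)) (v (s, m))).
pose G a :=
  bb (a, fun s => bb (a, fun t => bn (fun m => bn (fun n => G0 s t m n)))).
have GP a s t m n : boxed a s -> boxed a t -> G0 s t m n < G a.
  move=> sa ta; have lt_s := bbP a _ s sa; apply: le_lt_trans (lt_s _).
  have lt_t := bbP a _ t ta; apply/ltW/(lt_trans _ (lt_t _)).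
  exact/(lt_trans (bnP _ n))/(bnP _ m).
have [a [[[etaa xia] a_cof] [_ aG]]] := stat _
  (club_closed_under K_cardinal K_uncountable K_exp G
     (club_setT K_cardinal K_uncountable)).
have {}GP b s t m n : b < a -> boxed b s -> boxed b t -> G0 s t m n < a.
  by move=> /aG Gb sb tb; exact: lt_trans (GP b s t m n sb tb) Gb.
have [x [xa x_mon ax]] := cof_omega_seq a_cof.
pose f : ranked_seq := fun n => (x n, x n).
have f_sup : rank_sup f a by [].
have f_mon : rank_monotone f by move=> n; split=> /=.
have f_adm : admissible eta f by split=> //; right; exists a.
have f_unb b : b < a -> ~ forall n, (f n).1 < b.
  by move=> /ax[n bx] /(_ n); rewrite ltNge bx.
set g := H f; have [g_mon g_sup] : admissible xi g by exact: H_adm.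
(* If [g] were bounded below [a], its fibre bound [fib g] would be below [a] and would bound the
   ranks of [f]. *)
have g_unb b : b < a -> ~ forall n, (g n).1 <= b.
  move=> ba gb.
  have gbox : boxed b g.
    by move=> n; split=> //; apply: le_trans (gb n); have [] := g_mon n.
  have := GP b g g 0 0 ba gbox gbox; rewrite /G0 !gt_max.
  move=> /andP[/andP[_ fiba] _].
  by apply: (f_unb _ fiba) => n; exact: (fibP g).
(* The ranks of [g] cannot have supremum [a], which is missing from [xi]. *)
have [m [am mmin]] :
    exists m, a <= (g m).1 /\ forall i, (i < m)%N -> (g i).1 < a.
  have [|m am mmin] := has_least_nat (P := fun m => a <= (g m).1); last first.
    exists m; split=> // i im; rewrite ltNge; apply/negP => /mmin.
    by rewrite leEnat leqNgt im.
  apply: contrapT => /forallNP ga.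
  have {}ga n : (g n).1 < a by rewrite ltNge; apply/negP.
  case: g_sup => [[m gm]|[b gb xib]]; first exact: (g_unb _ (ga m)).
  apply: xia => /=; rewrite -xib; congr (xi _); apply: rank_sup_unique gb.
  split=> // y ya; apply: contrapT => /forallNP yg.
  apply: (g_unb _ ya) => n; apply: ltW; rewrite ltNge; exact/negP.
have [b [ba xb gb]] := finite_bound (xa 0) mmin.
(* The padding by [f 0] keeps [s] boxed below [a], whereas [g] reaches [a] at place [m]. *)
pose s i := if (i < m)%N then g i else f 0.
have s_box : boxed b s.
  move=> i; rewrite /s; case: ifP => // /gb gib; split=> //.
  by apply: le_trans gib; have [] := g_mon i.
have fA : A s m f.
  split=> // -[i [im _]]; rewrite /s im.
  by have [irr _] := strict_order_entry_lt; exact: irr.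
(* [A s m] has parameters bounded below [a], and [f] is above all its
   elements that are bounded below [a]; by the closure of [a] it is its
   maximum. *)
have A_lt h c : A s m h -> c < a -> (forall k, (h k).1 < c) -> seq_lt N h f.
  move=> [h_adm hA] ca hc.
  have [h_mon _] := h_adm.
  have hbox : boxed c h.
    move=> n; split; first exact: ltW.
    by apply/ltW/(le_lt_trans _ (hc n)); have [] := h_mon n.
  have := GP c h h 0 0 ca hbox hbox; rewrite /G0 !gt_max.
  move=> /andP[/andP[rHa _] _].
  (* By closure all ranks of [H h] are below [a], so if [H h] and [g] agree before [m], place [m]
     decides. Otherwise they first differ before [m], and membership in [A s m] gives the
     direction. *)
  have Hh_lt : seq_lt N (H h) g.
    have [eqm|] := pselect (forall j, (j < m)%N -> H h j = g j).
      exists m; split=> //; left; apply: lt_le_trans am.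
      exact: lt_trans (rP (H h) m) rHa.
    move=> /existsNP[j0 /not_implyP[j0m Hj0]].
    have [|i [im Hi] imin] :=
      has_least_nat (P := fun j => (j < m)%N /\ H h j <> g j).
      by exists j0.
    have eqi j : (j < i)%N -> H h j = g j.
      move=> ji; apply: contrapT => Hj.
      have /imin : (j < m)%N /\ H h j <> g j by split=> //; exact: ltn_trans im.
      by rewrite leEnat leqNgt ji.
    exists i; split=> //.
    have entry_tri : trichotomous entry_lt.
      by apply: trichotomous_prod_lex; [exact: trichotomous_lt|exact: N_tri].
    case: (entry_tri (H h i) (g i)) => // gHi; case: hA.
    exists i; rewrite /s im; split=> // j ji.
    by rewrite (ltn_trans ji im) eqi.
  case: (trichotomous_seq_lt h f) => [//|hf|fh].
    by case: (seq_irr g); rewrite -{1}/g /g -{1}hf.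
  case: (H_le f h f_adm h_adm fh) => [lt|eqH]; last first.
    by case: (seq_irr g); move: Hh_lt; rewrite -eqH.
  by case: (seq_irr g); exact: seq_tr lt Hh_lt.
have f_top : top s m f.
  split=> // h hA; case: (trichotomous_seq_lt h f) => [hf|->|[n [fh fhn]]].
  - by right.
  - by left.
  exfalso.
  have fn_lt i : (i < n.+1)%N -> (f i).1 < a by move=> _; exact: xa.
  have [c [ca bc fc]] := finite_bound ba fn_lt.
  (* Truncating [f] after place [n] gives a parameter boxed below [a]. An element of [A s m] above
     [f] then yields one with ranks below some point less than [a], against [A_lt]. *)
  pose t i := if (i < n.+1)%N then f i else f 0.
  have t_box : boxed c t.
    move=> i; rewrite /t; case: ifP => [/fc ?|_] //.
    by split; exact: le_trans bc.
  have s_box' : boxed c s.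
    by move=> i; have [s1 s2] := s_box i; split; exact: le_trans bc.
  have tE i : (i < n.+1)%N -> t i = f i by rewrite /t => ->.
  have := GP c s t m n ca s_box' t_box; rewrite /G0 !gt_max.
  move=> /andP[_ /andP[wa _]].
  have [|h' [h'A h't h'n] h'w] := wP s m t n.
    exists h; split=> // [j jn|]; last by rewrite tE.
    by rewrite tE ?fh // ltnW.
  apply: (seq_irr f); apply: seq_tr (A_lt h' _ h'A wa h'w).
  exists n; split=> [j jn|]; last by rewrite -tE.
  by rewrite h't // tE // ltnW.
have := GP b s s m 0 ba s_box s_box; rewrite /G0 !gt_max.
move=> /andP[_ /andP[_ va]].
by apply: (f_unb _ va) => n; exact: (vP s m).
Qed.

End Embeddings.
End RankedSequences.

(** * Rational coordinates *)

Section RationalLex.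
Local Open Scope ring_scope.

Definition rat_lt (q r : rat) : Prop := q < r.

(** An order embedding of the rationals into the negative ones: negative [q] go below $-1$, the
    others into $[-1,0)$. *)
Definition rat_neg (q : rat) : rat := if q < 0 then q - 1 else - (1 + q)^-1.

Lemma rat_neg_lt0 q : rat_neg q < 0.
Proof.
rewrite /rat_neg; case: (ltP q 0) => q0.
  by rewrite subr_lt0 (lt_trans q0).
by rewrite oppr_lt0 invr_gt0 ltr_wpDr.
Qed.

Lemma rat_neg_homo q r : q < r -> rat_neg q < rat_neg r.
Proof.
move=> qr; rewrite /rat_neg; case: (ltP q 0) => q0; case: (ltP r 0) => r0.
- by rewrite ltrD2r.
- rewrite (@lt_le_trans _ _ (-1))//; first by rewrite ltrBlDr addNr.
  by rewrite lerN2 invf_le1 ?ltr_wpDr// lerDl.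
- by move: (lt_le_trans qr (ltW r0)); rewrite ltNge q0.
- by rewrite ltrN2 ltf_pV2 ?ltrD2l// posrE ltr_wpDr.
Qed.

(** Two copies of the rationals, on either side of 0, let the rational coordinate absorb the bit of
    [place]. *)
Definition bool_rat (x : bool * rat) : rat :=
  if x.1 then - rat_neg (- x.2) else rat_neg x.2.

Lemma bool_rat_homo x y :
  prod_lex (fun b b' : bool => (b < b')%O) rat_lt x y ->
  bool_rat x < bool_rat y.
Proof.
case: x y => [[] q] [[] r] [//|[//= _]] /=; rewrite /bool_rat /=.
- by move=> qr; rewrite ltrN2; apply: rat_neg_homo; rewrite ltrN2.
- by move=> _; apply: lt_trans (rat_neg_lt0 _) _; rewrite oppr_gt0 rat_neg_lt0.
- exact: rat_neg_homo.
Qed.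

Lemma prod_lex_rat_dense T (P : T -> T -> Prop) x y :
  prod_lex P rat_lt x y ->
  exists2 z, prod_lex P rat_lt x z & prod_lex P rat_lt z y.
Proof.
move: x y => [x q] [y r] [/= Pxy|[/= <- qr]].
  by exists (x, q + 1); [right; split; rewrite // /rat_lt ltrDl|left].
by exists (x, (q + r) / 2); right; split; rewrite // /rat_lt ?midf_lt.
Qed.

Lemma prod_lex_rat_noend T (P : T -> T -> Prop) x :
  (exists y, prod_lex P rat_lt y x) /\ (exists y, prod_lex P rat_lt x y).
Proof.
case: x => x q; split; [exists (x, q - 1)|exists (x, q + 1)]; right; split=> //.
  by rewrite /rat_lt /= gtrDl oppr_lt0.
by rewrite /rat_lt /= ltrDl.
Qed.

End RationalLex.

(** * Coding the orders in $2^\kappa$ *)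

Section Coding.
Context {d : Order.disp_t} {K : orderType d}.
Local Open Scope order_scope.

Hypothesis K_cardinal : is_cardinal K.
Hypothesis K_uncountable : ~ countable [set: K].
Hypothesis K_exp : [set: short_seq K K] #= [set: K].
Hypothesis K_omega : forall L : Type,
  card_lt [set: L] [set: K] -> card_lt [set: nat -> L] [set: K].

Lemma small_countType (L : countType) : @small d K L.
Proof.
apply: (@small_inj _ _ _ _ (@pickle L)); first exact: pcan_inj (@pickleK L).
exact: small_nat.
Qed.

Lemma small_fun_inj L : @small d K L -> exists h : (L -> K) -> K, injective h.
Proof.
move=> [a [j [jinj ja]]]; have [k0] := cardinal_nonempty K_uncountable.
have [e eP] := short_seq_enum K_exp k0.
have h_ex (phi : L -> K) : exists y, forall x, e y (j x) = phi x.
  have [y ey] := eP a (fun z => if pselect (exists x, j x = z) is left x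
                              then phi (projT1 (cid x)) else k0).
  exists y => x; rewrite ey ja; case: pselect => [ex|[]]; last by exists x.
  by case: (cid ex) => x' /= /jinj ->.
have [h hP] := choice h_ex.
by exists h => phi psi hE; apply/funext => x; rewrite -hP hE hP.
Qed.

(** A point is a function from a countable index set to [K]: two coordinates for each place, and the
    code of the rational at [None]. By $\kappa^{<\kappa}=\kappa$ such functions inject into [K]. *)
Lemma ranked_rat_bij : exists c : K -> @ranked_seq d K * rat, bijective c.
Proof.
have [v vinj] := nat_inj K_cardinal K_uncountable.
have [h hinj] := small_fun_inj (small_countType (option (bool * nat)%type)).
pose phi (x : @ranked_seq d K * rat) (o : option (bool * nat)) : K :=
  match o with
  | None => v (pickle x.2)
  | Some (b, n) => if b then (x.1 n).1 else (x.1 n).2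
  end.
have phi_inj : injective phi.
  move=> [f q] [g r] /= fg.
  have /vinj/(pcan_inj (@pickleK _)) -> : v (pickle q) = v (pickle r).
    exact: (congr1 (fun u : option (bool * nat) -> K => u None) fg).
  congr (_, _); apply/funext => n.
  have := congr1 (fun u : option (bool * nat) -> K => u (Some (true, n))) fg.
  have := congr1 (fun u : option (bool * nat) -> K => u (Some (false, n))) fg.
  by rewrite /phi /=; case: (f n) (g n) => ? ? [? ?] /= -> ->.
have : [set: K] #= [set: @ranked_seq d K * rat].
  rewrite card_eq_le; apply/andP; split.
    apply: (@card_le_inj _ _ _ _ (fun x => (fun=> (x, x), 0%R))) => // x y _ _.
    by move=> [/(congr1 (@^~ 0))[]].
  by apply: (@card_le_inj _ _ _ _ (h \o phi)) => // x y _ _ /hinj/phi_inj.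
move=> /card_bijP[f [g fK gK]].
exists (fun x => \val (f (SigSub (in_setT x)))).
exists (fun y => \val (g (SigSub (in_setT y)))) => x.
  set q := f _; have -> : SigSub (in_setT (\val q)) = q by exact: val_inj.
  by rewrite /q fK.
set q := g _; have -> : SigSub (in_setT (\val q)) = q by exact: val_inj.
by rewrite /q gK.
Qed.

Section Reduction.
Variables (N : K -> K -> Prop) (c : K -> @ranked_seq d K * rat)
  (ci : @ranked_seq d K * rat -> K) (pi : seq K -> K) (k0 : K).
Hypothesis N_strict : strict_order N.
Hypothesis N_tri : trichotomous N.
Hypothesis N_universal : forall L (R : L -> L -> Prop),
  @small d K L -> strict_order R ->
  exists i : L -> K, forall x y, R x y -> N (i x) (i y).
Hypotheses (cK : cancel c ci) (ciK : cancel ci c).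
Hypothesis pi_inj : injective pi.
Hypothesis k0_min : forall x, k0 <= x.

Implicit Types (f g : @ranked_seq d K) (eta xi : 2^[K]).

(* To keep the domain independent of [eta], an inadmissible sequence is read
   as a second copy of an admissible constant sequence. *)
Definition place eta f : @ranked_seq d K * bool :=
  if `[< admissible eta f >] then (f, false)
  else (fun=> (ci (f, 0%R), ci (f, 0%R)), true).

Lemma place_admissible eta f : admissible eta (place eta f).1.
Proof.
rewrite /place; case: asboolP => //= _; split; first by move=> n; split=> /=.
by left; exists 0%N => n /=.
Qed.

Lemma placeT eta f : admissible eta f -> place eta f = (f, false).
Proof. by rewrite /place; case: asboolP. Qed.

Lemma place_inj eta : injective (place eta).
Proof.
move=> f g; rewrite /place; case: asboolP => _; case: asboolP => _ // [].
  by [].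
by move=> /(congr1 (@^~ 0%N)) [] /(can_inj ciK) [].
Qed.

Definition place_lt eta f g : Prop :=
  prod_lex (seq_lt N) (fun b b' : bool => b < b') (place eta f) (place eta g).

Definition point_lt eta :
    @ranked_seq d K * rat -> @ranked_seq d K * rat -> Prop :=
  prod_lex (place_lt eta) rat_lt.

Lemma strict_order_point_lt eta : strict_order (point_lt eta).
Proof.
apply: strict_order_prod_lex; last exact: strict_order_lt.
apply: (@strict_order_preim _ _ (place eta)).
apply: strict_order_prod_lex; last exact: strict_order_lt.
exact: strict_order_seq_lt.
Qed.

Lemma trichotomous_point_lt eta : trichotomous (point_lt eta).
Proof.
apply: trichotomous_prod_lex; last exact: trichotomous_lt.
apply: trichotomous_preim; first exact: place_inj.
apply: trichotomous_prod_lex; last exact: trichotomous_lt.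
exact: trichotomous_seq_lt.
Qed.

(** The least element [k0] is the ordinal 0, the index of the symbol $<$. *)
Definition order_code eta : 2^[K] :=
  fun k => `[< exists x y, k = pi [:: k0; x; y] /\ point_lt eta (c x) (c y) >].

Lemma nat_ordinal0 m : is_nat_ordinal 0 m <-> m = k0.
Proof.
rewrite /is_nat_ordinal II0 card_eq0; split=> [/eqP m0|->].
  apply/eqP; rewrite eq_le k0_min andbT leNgt; apply/negP => k0m.
  by have : below m k0 by []; rewrite m0.
by apply/eqP; rewrite -subset0 => x; rewrite /below /= ltNge k0_min.
Qed.

Lemma order_codeP eta (a : 2.-tuple K) x y : tval a = [:: x; y] ->
  coded_structure (L := order_vocabulary) pi (order_code eta) (n := 0%N) a <->
  point_lt eta (c x) (c y).
Proof.
rewrite /coded_structure => ->; split=> [[m /nat_ordinal0 -> /asboolP]|xy].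
  by move=> [x' [y' [/pi_inj[-> ->]]]].
exists k0; first exact/nat_ordinal0.
by apply/asboolP; exists x, y.
Qed.

Lemma order_code_DLO eta : Mod_DLO pi (order_code eta).
Proof.
have [irr tr] := strict_order_point_lt eta.
have codeP x y := @order_codeP eta [tuple x; y] x y erefl.
split=> [x|x y z|x y|x y|x].
- by rewrite codeP; exact: irr.
- by rewrite !codeP; exact: tr.
- case: (trichotomous_point_lt eta (c x) (c y)) => [?|/(can_inj cK) ?|?].
  + by constructor 1; apply/codeP.
  + by constructor 2.
  + by constructor 3; apply/codeP.
- rewrite codeP => /prod_lex_rat_dense[z xz zy].
  by exists (ci z); rewrite codeP ciK.
- have [[y yx] [z xz]] := prod_lex_rat_noend (place_lt eta) (c x).
  by split; [exists (ci y)|exists (ci z)]; rewrite codeP ciK.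
Qed.

(** Trichotomy of the source makes a strictly increasing map injective and order-reflecting. *)
Lemma order_code_embeddable eta xi :
  embeddable
    (coded_structure pi (order_code eta) : structure order_vocabulary K)
    (coded_structure pi (order_code xi)) <->
  exists h, forall x y, point_lt eta x y -> point_lt xi (h x) (h y).
Proof.
split=> [[h [hinj hP]]|[h hP]].
  exists (c \o h \o ci) => x y xy.
  have := hP 0%N [tuple ci x; ci y] erefl.
  rewrite (@order_codeP _ _ (ci x) (ci y))//.
  rewrite (@order_codeP _ _ (h (ci x)) (h (ci y)))//.
  by rewrite !ciK => <-.
have [irr tr] := strict_order_point_lt xi.
have hPV x y : point_lt xi (h x) (h y) -> point_lt eta x y.
  move=> hxy; case: (trichotomous_point_lt eta x y) => [//|xy|/hP hyx].
    by rewrite xy in hxy; case: (irr _ hxy).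
  by case: (irr (h x)); exact: tr hyx.
exists (ci \o h \o c); split.
  move=> x y /= /(can_inj ciK) hxy; apply: (can_inj cK).
  by case: (trichotomous_point_lt eta (c x) (c y)) => // /hP;
    rewrite hxy => /irr.
move=> n + n0; have -> : n = 0%N by [].
move=> a; case: a => [[|x [|y [|//]]] //= sa].
rewrite (@order_codeP _ _ x y)//.
rewrite (@order_codeP _ _ (ci (h (c x))) (ci (h (c y))))//.
by rewrite !ciK; split=> [/hP|/hPV].
Qed.

Lemma sq_omega_embeddable eta xi : sq_omega eta xi ->
  exists h, forall x y, point_lt eta x y -> point_lt xi (h x) (h y).
Proof.
move=> /existsNP[C /not_implyP[C_club /nonemptyPn C0]].
have [|e [e_adm e_lt]] := admissible_embed K_cardinal K_uncountable K_exp
    K_omega N_strict N_universal (eta := eta) (xi := xi) C_club.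
  move=> a Ca a_cof etaa; apply: contrapT => xia.
  by have : set0 a by rewrite -C0.
(* Images under [e] are admissible and always get bit [false], so the bit of the source moves into
   the rational. *)
exists (fun x => (e (place eta x.1).1, bool_rat ((place eta x.1).2, x.2))).
move=> [f q] [g r]; rewrite /point_lt.
have fe h : place xi (e (place eta h).1) = (e (place eta h).1, false).
  by apply/placeT/e_adm/place_admissible.
case=> /= [[fg|[fg fgb]]|[<- qr]].
- left; rewrite /place_lt !fe; left; apply: e_lt => //; exact: place_admissible.
- by right; rewrite /= fg; split=> //; apply: bool_rat_homo; left.
- by right; split=> //; apply: bool_rat_homo; right.
Qed.

Lemma embeddable_sq_omega eta xi (h : @ranked_seq d K * rat -> _) :
  (forall x y, point_lt eta x y -> point_lt xi (h x) (h y)) -> sq_omega eta xi.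
Proof.
move=> hP; have [irr _] := strict_order_point_lt xi.
have h_inj : injective h.
  move=> x y hxy; case: (trichotomous_point_lt eta x y) => // /hP;
  by rewrite hxy => /irr.
pose H f := (place xi (h (f, 0%R)).1).1.
apply: (no_admissible_embedding K_cardinal K_uncountable K_exp K_omega
  N_strict N_tri (H := H)).
- by move=> f _; exact: place_admissible.
- move=> f g f_adm g_adm fg.
  have : point_lt eta (f, 0%R) (g, 0%R).
    by left; rewrite /place_lt !placeT//; left.
  by move=> /hP[[?|[? _]]|[fg' _]]; [left|right|right; rewrite /H fg'].
move=> g.
have [r rP] := choice (fun f => nat_bounded K_cardinal K_uncountable K_exp
  (fun n => (f n).1)).
(* Over a fixed [g], a bit and a rational determine [h (f, 0)], hence [f]. Fibres of [H] are thus
   countable, and regularity bounds their ranks. *)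
pose fib f (x : bool * rat) := place xi (h (f, 0%R)).1 = (g, x.1) /\
  (h (f, 0%R)).2 = x.2.
pose phi x := if pselect (exists f, fib f x) is left e then r (projT1 (cid e))
  else k0.
have [b phib] := small_bounded K_cardinal K_uncountable K_exp phi
  (small_countType _).
exists b => f _ Hf n.
pose x := ((place xi (h (f, 0%R)).1).2, (h (f, 0%R)).2).
have fx : fib f x by split=> //; rewrite -Hf /H /=; case: (place _ _).
apply: lt_trans (rP f n) _; apply: le_lt_trans (phib x).
rewrite /phi; case: pselect => [e|[]]; last by exists f.
case: (cid e) => f' [] /=; rewrite -fx.1 => /place_inj f1 f2.
suff /h_inj[->] : h (f', 0%R) = h (f, 0%R) by [].
by move: f1 f2; rewrite /x /=; case: (h _) (h _) => ? ? [? ?] /= -> ->.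
Qed.

(** At most one value of [eta] matters, the one at the rank supremum of [f]; any [b] beyond that
    point will do. *)
Lemma admissible_local f : exists b : K, forall eta xi,
  (forall x, x < b -> eta x = xi x) -> admissible eta f -> admissible xi f.
Proof.
have [[a fa]|nsup] := pselect (exists a, rank_sup f a); last first.
  exists k0 => eta xi _ [fmon [?|[a fa]]]; first by split=> //; left.
  by case: nsup; exists a.
have [b ab] := cardinal_nomax K_cardinal K_uncountable a.
exists b => eta xi etaxi [fmon [?|[a' fa' etaa]]]; split=> //; first by left.
right; exists a' => //; rewrite -etaxi//.
by rewrite (rank_sup_unique fa' fa).
Qed.

Lemma order_code_local k : exists b : K, forall eta xi,
  (forall x, x < b -> eta x = xi x) -> order_code eta k = order_code xi k.
Proof.
have place_local f : exists b : K, forall eta xi,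
    (forall x, x < b -> eta x = xi x) -> place eta f = place xi f.
  have [b bP] := admissible_local f; exists b => eta xi etaxi; rewrite /place.
  have -> // : `[< admissible eta f >] = `[< admissible xi f >].
  by apply: asbool_equiv_eq; split; apply: bP => // x /etaxi.
have [[x [y kE]]|nk] := pselect (exists x y, k = pi [:: k0; x; y]); last first.
  exists k0 => eta xi _; rewrite /order_code.
  by apply: asbool_equiv_eq; split=> -[x [y [kE _]]]; case: nk; exists x, y.
have [b1 b1P] := place_local (c x).1; have [b2 b2P] := place_local (c y).1.
exists (Order.max b1 b2) => eta xi etaxi.
have p1 : place eta (c x).1 = place xi (c x).1.
  by apply: b1P => z z1; apply: etaxi; rewrite lt_max z1.
have p2 : place eta (c y).1 = place xi (c y).1.
  by apply: b2P => z z1; apply: etaxi; rewrite lt_max z1 orbT.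
apply: asbool_equiv_eq; split=> -[x' [y' [+ xy]]]; rewrite kE => /pi_inj[xE yE];
  exists x, y; split=> //; move: xy;
  by rewrite -xE -yE /point_lt /prod_lex /place_lt p1 p2.
Qed.

(** Each bit of the code depends on a bounded part of [eta]; by regularity the bits below a given
    length share one bound. *)
Lemma order_code_continuous : continuous order_code.
Proof.
move=> eta U /(nbhs_boundedP k0)[p peta pU].
have [b bP] := choice order_code_local.
have [e be] := small_bounded K_cardinal K_uncountable K_exp
  (fun x : {x | x <= projT1 p} => b (sval x))
  (small_segment K_cardinal K_uncountable (projT1 p)).
apply/(nbhs_boundedP k0).
exists (existT _ e (fun x => eta (sval x))) => // xi xieta.
apply: pU => -[x xp]; rewrite -peta /=; apply: bP => z zb.
have ze : z < e by exact: lt_trans zb (be (exist _ x (ltW xp))).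
exact: (xieta (exist _ z ze)).
Qed.

End Reduction.
End Coding.

Theorem theorem4p3 (d : Order.disp_t) (K : orderType d) (pi : seq K -> K)
  (K_cardinal : is_cardinal K)
  (K_uncountable : ~ countable [set: K])
  (K_exp : [set: short_seq K K] #= [set: K])
  (K_omega : forall L : Type,
     card_lt [set: L] [set: K] -> card_lt [set: nat -> L] [set: K])
  (pi_bij : bijective pi) :
  exists F : 2^[K] -> Mod_DLO pi,
    continuous_reduction (@sq_omega d K) (@sq_DLO d K pi) F.
Proof.
have [N [N_strict N_tri N_univ]] :=
  universal_order K_cardinal K_uncountable K_exp.
have [c [ci cK ciK]] := ranked_rat_bij K_cardinal K_uncountable K_exp.
have [k1] := cardinal_nonempty K_uncountable.
have [|k0 _ k0_min] := cardinal_has_least K_cardinal (P := fun=> True).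
  by exists k1.
have {}k0_min x : (k0 <= x)%O by exact: k0_min.
have pi_inj := bij_inj pi_bij.
exists (fun eta => SigSub (mem_set (order_code_DLO N_strict N_tri cK ciK
  pi_inj k0_min eta))).
split; first exact/continuous_comp_initial/order_code_continuous.
move=> eta xi; rewrite /sq_DLO order_code_embeddable//; split.
  exact: sq_omega_embeddable.
by move=> [h hP]; exact: embeddable_sq_omega hP.
Qed.
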